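(* Let $\langle A_1,\prec_1\rangle$ and $\langle A_2,\prec_2\rangle$ be S4-subordination algebras with dual spaces $\langle X_1,\tau_1,\tau_{S_1}\rangle$ and $\langle X_2,\tau_2,\tau_{S_2}\rangle$. Let $h:A_1\to A_2$ be a meet-homomorphism with dual Boolean relation $R\subseteq X_2\times X_1$. Then the following conditions are equivalent: (1) $h$ satisfies the conditions (MO) and (QH); (2) $h_R(\mathrm{int}_{S_1}(U))=\mathrm{int}_{S_2}(h_R(U))$ for all $U\in\mathrm{Clop}(X_1)$.
   Context: A subordination on a Boolean algebra $A$ is a binary relation $\prec$ on $A$ such that: (S1) $0\prec 0$ and $1\prec 1$; (S2) $a\prec b$ and $a\prec c$ imply $a\prec b\wedge c$; (S3) $a\prec c$ and $b\prec c$ imply $a\vee b\prec c$; (S4) $a\leq b\prec c\leq d$ implies $a\prec d$. The pair $\langle A,\prec\rangle$ is an S4-subordination algebra if moreover (S5) $a\prec b$ implies $a\leq b$, and (S6) $a\prec b$ implies that there is $c\in A$ with $a\prec c\prec b$. The dual space $\langle X,\tau,\tau_S\rangle$ of an S4-subordination algebra $\langle A,\prec\rangle$ is: $X=\mathrm{Ul}(A)$, the set of ultrafilters of $A$; $\tau$ is the Stone topology with base $\{\varphi(a):a\in A\}$, $\varphi(a)=\{x\in X:a\in x\}$; $\tau_S$ is the topology with base the sets $\{x\in X:x\cap{\downarrow}a\neq\emptyset\}$, $a\in A$, where ${\downarrow}a=\{b\in A:b\prec a\}$. $\mathrm{Clop}(X)$ is the set of clopen subsets of $\langle X,\tau\rangle$;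 $\mathrm{int}_S$ denotes interior with respect to $\tau_S$. A meet-homomorphism $h:A_1\to A_2$ is a map with $h(1)=1$ and $h(a\wedge b)=h(a)\wedge h(b)$. Its dual Boolean relation is $R=\{(x,y)\in X_2\times X_1:h^{-1}(x)\subseteq y\}$; $R(x)=\{y\in X_1:(x,y)\in R\}$. For $Y\subseteq X_1$, $h_R(Y)=\{x\in X_2:R(x)\subseteq Y\}$. Conditions: (MO) for all $a,b\in A_1$, $a\prec_1 b$ implies $h(a)\prec_2 h(b)$; (QH) for $a\in A_2$, $b\in A_1$, if $a\prec_2 h(b)$ then there exists $c\in A_1$ such that $a\leq h(c)$ and $c\prec_1 b$. *)

(* Defs.v *)
From HB Require Import structures.
From mathcomp Require Import all_boot all_order.
From mathcomp Require Import all_classical.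
From mathcomp Require Export topology_structure.

Set Implicit Arguments.
Unset Strict Implicit.
Unset Printing Implicit Defensive.

Import Order.TTheory.

Local Open Scope classical_set_scope.

(* Boolean algebras are [ctbDistrLatticeType]s, which need not
   satisfy \bot <> \top; the one-element algebra is included. *)

Record s4_subordination (d : Order.disp_t) (A : ctbDistrLatticeType d) :=
  S4Subordination {
    prec :> A -> A -> Prop;
    prec00 : prec \bot%O \bot%O;
    prec11 : prec \top%O \top%O;
    prec_meet : forall a b c, prec a b -> prec a c -> prec a (b `&` c)%O;
    prec_join : forall a b c, prec a c -> prec b c -> prec (a `|` b)%O c;
    prec_mono : forall a b c d,
      (a <= b)%O -> prec b c -> (c <= d)%O -> prec a d;
    prec_le : forall a b, prec a b -> (a <= b)%O;
    prec_dense : forall a b, prec a b -> exists2 c, prec a c & prec c b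
  }.

Section Ultrafilters.
Context (d : Order.disp_t) (A : ctbDistrLatticeType d).

Definition proper_filter (F : set A) : Prop :=
  [/\ F \top%O,
      forall a b, F a -> F b -> F (a `&` b)%O,
      forall a b, (a <= b)%O -> F a -> F b
    & ~ F \bot%O].

Record ultrafilter := Ultrafilter {
  ultra_set :> set A;
  ultra_proper : proper_filter ultra_set;
  ultra_max : forall G : set A, proper_filter G -> ultra_set `<=` G ->
    G = ultra_set
}.

Definition stone_map (a : A) : set ultrafilter := [set x : ultrafilter | (x : set A) a].

End Ultrafilters.

(* The two topologies live on the same set of ultrafilters; [stone_space A] and
   [subordination_space s] are copies of [ultrafilter A], convertible to it,
   whose only purpose is to select the topology. *)
Definition stone_space (d : Order.disp_t) (A : ctbDistrLatticeType d) : Type :=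
  ultrafilter A.

Definition subordination_space (d : Order.disp_t) (A : ctbDistrLatticeType d)
  (s : s4_subordination A) : Type := ultrafilter A.

Section StoneTopology.
Context (d : Order.disp_t) (A : ctbDistrLatticeType d).

HB.instance Definition _ := gen_eqMixin (stone_space A).
HB.instance Definition _ := gen_choiceMixin (stone_space A).

Let base : set (set (stone_space A)) := range (@stone_map d A).

Let base_cover : \bigcup_(V in base) V = setT.
Proof.
apply/seteqP; split => // x _; exists (stone_map \top%O); first by exists \top%O.
by case: (ultra_proper x).
Qed.

Let base_join (V W : set (stone_space A)) (x : stone_space A) :
  base V -> base W -> V x -> W x ->
  exists Z, [/\ base Z, Z x & Z `<=` V `&` W].
Proof.
move=> [a _ <-] [b _ <-] xa xb; exists (stone_map (a `&` b)%O); split.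
- by exists (a `&` b)%O.
- by case: (ultra_proper x) => _ xI _ _; apply: xI.
- move=> y yab; case: (ultra_proper y) => _ _ yS _.
  by split; apply: yS yab; rewrite (leIl, leIr).
Qed.

HB.instance Definition _ :=
  isBaseTopological.Build (stone_space A) base_cover base_join.

End StoneTopology.

Section SubordinationTopology.
Context (d : Order.disp_t) (A : ctbDistrLatticeType d).
Variable s : s4_subordination A.

HB.instance Definition _ := gen_eqMixin (subordination_space s).
HB.instance Definition _ := gen_choiceMixin (subordination_space s).

Definition prec_down (a : A) : set A := [set b | s b a].

Definition prec_basic (a : A) : set (ultrafilter A) :=
  [set x : ultrafilter A | x `&` prec_down a !=set0].

Let base : set (set (subordination_space s)) := range prec_basic.

Let base_cover : \bigcup_(V in base) V = setT.
Proof.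
apply/seteqP; split => // x _; exists (prec_basic \top%O).
  by exists \top%O.
by exists \top%O; split; [case: (ultra_proper x) | exact: prec11].
Qed.

Let base_join (V W : set (subordination_space s)) (x : subordination_space s) :
  base V -> base W -> V x -> W x ->
  exists Z, [/\ base Z, Z x & Z `<=` V `&` W].
Proof.
move=> [a _ <-] [b _ <-] [a' [xa' sa]] [b' [xb' sb]].
exists (prec_basic (a `&` b)%O); split.
- by exists (a `&` b)%O.
- exists (a' `&` b')%O; split.
    by case: (ultra_proper x) => _ xI _ _; apply: xI.
  by apply: prec_meet; [apply: prec_mono sa _ | apply: prec_mono sb _];
     rewrite ?leIl ?leIr.
- move=> y [c [yc sc]]; split; exists c; split => //;
  by apply: (prec_mono (lexx c) sc); rewrite (leIl, leIr).
Qed.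

HB.instance Definition _ :=
  isBaseTopological.Build (subordination_space s) base_cover base_join.

End SubordinationTopology.

Section MeetHomomorphisms.
Context (d1 d2 : Order.disp_t).
Context (A1 : ctbDistrLatticeType d1) (A2 : ctbDistrLatticeType d2).

Definition meet_homomorphism (h : A1 -> A2) : Prop :=
  h \top%O = \top%O /\ forall a b, h (a `&` b)%O = (h a `&` h b)%O.

Definition dual_relation (h : A1 -> A2) :
  set (ultrafilter A2 * ultrafilter A1) :=
  [set xy : ultrafilter A2 * ultrafilter A1 | h @^-1` xy.1 `<=` xy.2].

Definition box (R : set (ultrafilter A2 * ultrafilter A1))
  (Y : set (ultrafilter A1)) : set (ultrafilter A2) :=
  [set x | xsection R x `<=` Y].

Definition MO (s1 : s4_subordination A1) (s2 : s4_subordination A2)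
  (h : A1 -> A2) : Prop :=
  forall a b, s1 a b -> s2 (h a) (h b).

Definition QH (s1 : s4_subordination A1) (s2 : s4_subordination A2)
  (h : A1 -> A2) : Prop :=
  forall (a : A2) (b : A1), s2 a (h b) ->
    exists2 c : A1, (a <= h c)%O & s1 c b.

End MeetHomomorphisms.

Definition Clop (d : Order.disp_t) (A : ctbDistrLatticeType d)
  (U : set (ultrafilter A)) : Prop := @clopen (stone_space A) U.

Definition int_S (d : Order.disp_t) (A : ctbDistrLatticeType d)
  (s : s4_subordination A) (U : set (ultrafilter A)) : set (ultrafilter A) :=
  @interior (subordination_space s) U.

(* Main.v *)
Require Import Defs.
From mathcomp Require Import all_boot all_order.
From mathcomp Require Import all_classical.

(** Both sides of condition (2) can be computed for a clopen set.  Write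
    [phi a] for [stone_map a].  Every clopen set is some [phi b]
    ([clopen_stone_map]), and the interior of [phi b] for the subordination
    topology consists of the ultrafilters that contain an element below [b] for
    the subordination ([int_S_stone_map]); this is where interpolation (S6) is
    used.  Since [box R (phi b) = phi (h b)], condition (2) at [phi b] says that
    an ultrafilter [x] of [A2] contains some [h c] with [c] subordinate to [b]
    iff it contains some [a] subordinate to [h b].

    Under this reading (MO) gives one inclusion and (QH) the other.
    Conversely, suppose that (MO) fails at [a], [b].  Then the filter of all
    elements above [h a] misses the ideal of all elements subordinate to [h b],
    and an ultrafilter separating them contradicts (2).  Likewise, if (QH) fails
    at [a], [b], then the filter of all elements above [a] misses the ideal
    generated by the [h c] with [c] subordinate to [b].

    Everything therefore rests on the separation of a filter from a disjoint
    ideal by an ultrafilter ([filter_ideal_separation]), itself a consequence of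
    Zorn's lemma.  Even the description of the clopen sets, usually drawn from
    the compactness of the Stone space, is a direct instance of it. *)

Set Implicit Arguments.
Unset Strict Implicit.
Unset Printing Implicit Defensive.

Import Order.Theory.

Local Open Scope classical_set_scope.
Local Open Scope order_scope.

(** * Filters, ideals and ultrafilters *)

Section Separation.
Context (d : Order.disp_t) (A : ctbDistrLatticeType d).
Implicit Types (F G I : set A) (a b : A) (x : ultrafilter A).

Definition lattice_filter F : Prop :=
  [/\ F \top,
      forall a b, F a -> F b -> F (a `&` b)
    & forall a b, a <= b -> F a -> F b].

Definition lattice_ideal I : Prop :=
  [/\ I \bot,
      forall a b, I a -> I b -> I (a `|` b)
    & forall a b, a <= b -> I b -> I a].

Lemma principal_filter a : lattice_filter [set b | a <= b].
Proof.
by split => [|b c /= ab ac|b c /= bc ab];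
  [exact: lex1 | rewrite lexI ab ac | exact: le_trans ab bc].
Qed.

Lemma principal_ideal b : lattice_ideal [set a | a <= b].
Proof.
by split => [|a c /= ab cb|a c /= ac cb];
  [exact: le0x | rewrite leUx ab cb | exact: le_trans ac cb].
Qed.

Lemma ultra_top x : ultra_set x \top.
Proof. by case: (Defs.ultra_proper x). Qed.

Lemma ultra_meet x a b :
  ultra_set x a -> ultra_set x b -> ultra_set x (a `&` b).
Proof. by case: (Defs.ultra_proper x) => _ + _ _; apply. Qed.

Lemma ultra_up x a b : a <= b -> ultra_set x a -> ultra_set x b.
Proof. by case: (Defs.ultra_proper x) => _ _ + _; apply. Qed.

Lemma ultra_bot x : ~ ultra_set x \bot.
Proof. by case: (Defs.ultra_proper x). Qed.

Lemma ultra_compl_false x a : ultra_set x a -> ultra_set x (~` a) -> False.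
Proof.
move=> xa xCa; apply: (@ultra_bot x); rewrite -(meetxC a).
exact: ultra_meet.
Qed.

(** If neither [a] nor its complement were in [x], the filter generated by [x]
    and [a] would be a proper one, strictly larger than [x]. *)
Lemma ultra_compl x a : ~ ultra_set x a -> ultra_set x (~` a).
Proof.
move=> xNa; apply: contrapT => xNCa; apply: xNa.
pose G : set A := [set c | exists2 e, ultra_set x e & e `&` a <= c].
have xG : ultra_set x `<=` G by move=> e xe; exists e => //; exact: leIl.
have Gproper : proper_filter G.
  split.
  - exact: xG (ultra_top x).
  - move=> b c [e xe eb] [f xf fc]; exists (e `&` f); first exact: ultra_meet.
    rewrite lexI (le_trans _ eb) ?(le_trans _ fc) //.
      by rewrite leI2 ?leIr.
    by rewrite leI2 ?leIl.
  - by move=> b c bc [e xe eb]; exists e => //; exact: le_trans eb bc.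
  - move=> [e xe]; rewrite lex0 disj_leC => eCa.
    exact: xNCa (ultra_up eCa xe).
rewrite -(ultra_max Gproper xG); exists \top; first exact: ultra_top.
exact: leIr.
Qed.

Lemma ultra_prime x a b :
  ultra_set x (a `|` b) -> ultra_set x a \/ ultra_set x b.
Proof.
move=> xab; have [xa|/ultra_compl xCa] := pselect (ultra_set x a); first by left.
right; apply: (ultra_up _ (ultra_meet xab xCa)).
by rewrite meetUl meetxC join0x leIl.
Qed.

(** Zorn's lemma is applied to the sets [G] such that [F `|` G] is a proper
    filter, and not to the proper filters containing [F], so that the union of
    the empty chain is admissible. *)
Lemma ultrafilter_extension F : proper_filter F ->
  exists x, F `<=` ultra_set x.
Proof.
move=> Fproper.
have [C CP Ctot|M [MP Mmax]] :=
  @Zorn_bigcup A [set G | proper_filter (F `|` G)%classic]; last first.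
  have FM_max G : proper_filter G -> (F `|` M `<=` G -> G = F `|` M)%classic.
    move=> Gproper FMG.
    have FG : (F `|` G)%classic = G by apply/setUidPr => a Fa; apply: FMG; left.
    apply/seteqP; split => // a Ga; right; move: a Ga; apply: contrapT => GNM.
    apply: (Mmax G); last by rewrite /= FG.
    by split => // a Ma; apply: FMG; right.
  by exists (Ultrafilter MP FM_max) => a Fa; left.
pose U := (F `|` \bigcup_(X in C) X)%classic.
(* Two elements are compared inside one member of the chain, or inside [F] when
   the chain contributes neither, so [U] inherits each closure property. *)
have common a b : U a -> U b ->
    exists G, [/\ proper_filter G, G `<=` U, G a & G b].
  have inC X : C X -> (F `|` X)%classic `<=` U.
    by move=> CX; apply: setUS; exact: bigcup_sup.
  move=> [Fa|[X CX Xa]] [Fb|[Y CY Yb]].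
  - by exists F; split => //; exact: subsetUl.
  - by exists (F `|` Y)%classic; split; [exact: CP | exact: inC | left | right].
  - by exists (F `|` X)%classic; split; [exact: CP | exact: inC | right | left].
  - have [XY|YX] := Ctot _ _ CX CY.
    + by exists (F `|` Y)%classic; split;
        [exact: CP | exact: inC | right; exact: XY | right].
    + by exists (F `|` X)%classic; split;
        [exact: CP | exact: inC | right | right; exact: YX].
split.
- by left; case: Fproper.
- move=> a b aU bU; have [G [[_ GI _ _] GU Ga Gb]] := common a b aU bU.
  exact/GU/GI.
- move=> a b ab aU; have [G [[_ _ GS _] GU Ga _]] := common a a aU aU.
  exact/GU/(GS _ _ ab).
- by move=> bU; have [G [[_ _ _ G0] _ /G0]] := common _ _ bU bU.
Qed.

(** The filter generated by [F] and the complements of the elements of [I] is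
    proper, and any ultrafilter extending it does the job. *)
Lemma filter_ideal_separation F I : lattice_filter F -> lattice_ideal I ->
  (forall a, F a -> ~ I a) ->
  exists2 x, F `<=` ultra_set x & (forall a, ultra_set x a -> ~ I a).
Proof.
move=> [F1 FI FS] [I0 IU IS] FNI.
(* [f <= a `|` i] is [f `&` ~` i <= a] with the complement moved across. *)
pose G : set A := [set a | exists f i, [/\ F f, I i & f <= a `|` i]].
have Gproper : proper_filter G.
  split.
  - by exists \top, \bot; split => //; exact: leUl.
  - move=> a b [f [i [Ff Ii fai]]] [g [j [Fg Ij gbj]]].
    exists (f `&` g), (i `|` j); split; [exact: FI | exact: IU |].
    rewrite joinIl leI2 //.
      by apply: le_trans fai _; rewrite leU2 ?leUl.
    by apply: le_trans gbj _; rewrite leU2 ?leUr.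
  - move=> a b ab [f [i [Ff Ii fai]]]; exists f, i; split => //.
    by apply: le_trans fai _; rewrite leU2.
  - move=> [f [i [Ff Ii]]]; rewrite join0x => fi.
    exact: FNI (FS _ _ fi Ff) Ii.
have [x Gx] := ultrafilter_extension Gproper.
exists x => [a Fa|a xa Ia]; first by apply: Gx; exists a, \bot; rewrite leUl.
apply: (ultra_compl_false xa); apply: Gx; exists \top, a.
by rewrite joinCx.
Qed.

(** The contrapositive of separation: this is how a fact known for every
    ultrafilter is turned into one witness in the algebra. *)
Lemma filter_ideal_meet F I : lattice_filter F -> lattice_ideal I ->
  (forall x, F `<=` ultra_set x -> exists2 a, ultra_set x a & I a) ->
  exists2 a, F a & I a.
Proof.
move=> Ffilter Iideal FI; apply: contrapT => FNI.
have [a Fa Ia|x Fx xNI] := filter_ideal_separation Ffilter Iideal.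
  by apply: FNI; exists a.
by have [a /xNI] := FI x Fx.
Qed.

Lemma stone_map_le a b : stone_map a `<=` stone_map b -> a <= b.
Proof.
move=> ab; have [x ax|c /= ac cb] :=
  filter_ideal_meet (principal_filter a) (principal_ideal b).
  by exists b => //=; apply: ab; apply: ax => /=.
exact: le_trans ac cb.
Qed.

Lemma setC_stone_map a : (~` stone_map a)%classic = stone_map (~` a)%O.
Proof.
apply/seteqP; split => [x /= xNa|x /= xCa xa]; first exact: ultra_compl.
exact: ultra_compl_false xCa.
Qed.

End Separation.

(** * The two topologies *)

Section Topologies.
Context (d : Order.disp_t) (A : ctbDistrLatticeType d).
Implicit Types (a b : A) (U : set (ultrafilter A)).

Lemma stone_openP U : @open (stone_space A) U <->
  forall x, U x -> exists2 a, ultra_set x a & stone_map a `<=` U.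
Proof.
split => [[B Brange <-] x [V BV Vx]|Ucover].
  have [a _ aV] := Brange _ BV; rewrite -aV in Vx.
  by exists a => // y ya; exists V => //; rewrite -aV.
exists [set V | range (@stone_map _ A) V /\ V `<=` U]; first by move=> V [].
apply/seteqP; split => [x [V [_ VU] /VU]//|x Ux].
by have [a xa aU] := Ucover x Ux; exists (stone_map a) => //;
  split => //; exists a.
Qed.

Lemma stone_map_clopen a : Clop (stone_map a).
Proof.
have aopen b : @open (stone_space A) (stone_map b).
  by apply/stone_openP => x xb; exists b.
by split => //; rewrite -openC setC_stone_map.
Qed.

(** Write [phi] for [stone_map].  The [a] with [phi a `<=` U] form an ideal, the
    [a] with [U `<=` phi a] a filter, and a common element is what is sought.  An
    ultrafilter separating them could be neither in [U] nor in its complement,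
    since both are open. *)
Lemma clopen_stone_map U : Clop U -> exists a, U = stone_map a.
Proof.
move=> [/stone_openP Uopen]; rewrite -openC => /stone_openP UCopen.
have [||x Fx|a Ua aU] := @filter_ideal_meet _ A
    [set a | U `<=` stone_map a] [set a | stone_map a `<=` U].
- split => [x _|a b Ua Ub x Ux|a b ab Ua x Ux].
  + exact: ultra_top.
  + by apply: ultra_meet; [exact: Ua | exact: Ub].
  + exact: ultra_up ab (Ua x Ux).
- split => [x /ultra_bot //|a b aU bU x /ultra_prime[/aU|/bU] //|a b ab bU x xa].
  exact/bU/(ultra_up ab xa).
- have [/Uopen[a xa aU]|/UCopen[a xa aUC]] := pselect (U x); first by exists a.
  exfalso; apply: (ultra_compl_false xa); apply: Fx => y Uy.
  by apply: ultra_compl => /aUC /(_ Uy).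
- by exists a; apply/seteqP.
Qed.

Variable s : s4_subordination A.

Lemma prec_down_ideal b : lattice_ideal (prec_down s b).
Proof.
split => [|a c|a c ac sc].
- by apply: (prec_mono (lexx _) (prec00 s)); exact: le0x.
- exact: prec_join.
- exact: prec_mono ac sc (lexx b).
Qed.

Lemma int_SP U x : int_S s U x <->
  exists2 a, prec_basic s a x & prec_basic s a `<=` U.
Proof.
rewrite /int_S /interior nbhsE; split => [[V [[B Brange VE] Vx] VU]|[a xa aU]].
  move: Vx; rewrite -VE => -[W BW Wx].
  have [a _ aW] := Brange _ BW; rewrite -aW in Wx.
  by exists a => // y ya; apply: VU; rewrite -VE; exists W => //; rewrite -aW.
exists (prec_basic s a) => //; split => //.
exists [set prec_basic s a]; first by move=> _ ->; exists a.
by rewrite bigcup_set1.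
Qed.

(** If the basic set of [a] lies in [stone_map b], then every [c] subordinate to
    [a] is below [b].  To find the witness subordinate, and not merely below, [b],
    interpolate: an [e] subordinate to [a] lies between. *)
Lemma int_S_stone_map b : int_S s (stone_map b) = prec_basic s b.
Proof.
apply/seteqP; split => x; last first.
  move=> xb; apply/int_SP; exists b => // y [c [yc /prec_le cb]].
  exact: ultra_up cb yc.
move=> /int_SP[a [c [xc ca]] ab]; exists c; split => //.
have [e ce ea] := prec_dense ca.
apply: (prec_mono (lexx c) ce); apply: stone_map_le => y ye.
by apply: ab; exists e.
Qed.

End Topologies.

(** * Meet-homomorphisms *)

Section MeetHomomorphism.
Context (d1 d2 : Order.disp_t).
Context (A1 : ctbDistrLatticeType d1) (A2 : ctbDistrLatticeType d2).
Variables (h : A1 -> A2) (hh : meet_homomorphism h).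

Lemma meet_hom_le a b : a <= b -> h a <= h b.
Proof. by move=> /meet_idPl ab; rewrite -ab hh.2 leIr. Qed.

Lemma preimage_ultra_filter (x : ultrafilter A2) :
  lattice_filter (h @^-1` ultra_set x).
Proof.
split => [|a b xa xb|a b ab].
- by rewrite /preimage /= hh.1; exact: ultra_top.
- by rewrite /preimage /= hh.2; exact: ultra_meet.
- exact/ultra_up/meet_hom_le.
Qed.

Lemma box_dual_relationP (U : set (ultrafilter A1)) (x : ultrafilter A2) :
  box (dual_relation h) U x <->
  forall y : ultrafilter A1, h @^-1` ultra_set x `<=` ultra_set y -> U y.
Proof.
by split => [xU y xy|xU y /xsectionP xy]; apply: xU => //; exact/xsectionP.
Qed.

(** The preimage of [x] under [h] is a filter, and [R(x)] is the set of
    ultrafilters that extend it; so this is filter-ideal separation for that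
    preimage and [I]. *)
Lemma box_meets_ideal (I : set A1) (x : ultrafilter A2) : lattice_ideal I ->
  box (dual_relation h) [set y | exists2 a, ultra_set y a & I a] x <->
  exists2 a, ultra_set x (h a) & I a.
Proof.
move=> Iideal; rewrite box_dual_relationP; split => [xI|[a xa Ia] y xy].
  exact: (filter_ideal_meet (preimage_ultra_filter x) Iideal xI).
by exists a => //; exact: xy.
Qed.

Lemma box_stone_map b : box (dual_relation h) (stone_map b) = stone_map (h b).
Proof.
have -> : stone_map b =
    [set y : ultrafilter A1 | exists2 a, ultra_set y a & a <= b].
  apply/seteqP; split => y; first by exists b.
  by move=> [a ya ab]; exact: ultra_up ab ya.
apply/seteqP; split => x; rewrite (box_meets_ideal x (principal_ideal b)).
  by move=> [a xa ab]; exact: ultra_up (meet_hom_le ab) xa.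
by move=> xb; exists b => /=.
Qed.

Lemma box_prec_basic (s1 : s4_subordination A1) b (x : ultrafilter A2) :
  box (dual_relation h) (prec_basic s1 b) x <->
  exists2 c, ultra_set x (h c) & s1 c b.
Proof.
rewrite -(box_meets_ideal x (prec_down_ideal s1 b)).
suff -> : prec_basic s1 b =
  [set y | exists2 a, ultra_set y a & prec_down s1 b a] by [].
by apply/seteqP; split => y [a]; [case=> ya ab | move=> ya ab]; exists a.
Qed.

(** A directed union of principal ideals: [h] need not preserve joins, but
    [h c `|` h c' <= h (c `|` c')]. *)
Lemma prec_image_ideal (s1 : s4_subordination A1) b :
  lattice_ideal [set e | exists2 c, e <= h c & s1 c b].
Proof.
have [down0 downU _] := prec_down_ideal s1 b.
split => [|e f [c ec cb] [c' fc' c'b]|e f ef [c fc cb]].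
- by exists \bot; first exact: le0x.
- exists (c `|` c'); last exact: downU.
  rewrite leUx (le_trans ec) ?(le_trans fc') //; apply: meet_hom_le;
  by rewrite ?leUl ?leUr.
- by exists c => //; exact: le_trans ef fc.
Qed.

End MeetHomomorphism.

Theorem corollary36 (d1 d2 : Order.disp_t)
    (A1 : ctbDistrLatticeType d1) (A2 : ctbDistrLatticeType d2)
    (s1 : s4_subordination A1) (s2 : s4_subordination A2)
    (h : A1 -> A2) (hh : meet_homomorphism h) :
  (MO s1 s2 h /\ QH s1 s2 h) <->
  (forall U : set (ultrafilter A1), Clop U ->
     box (dual_relation h) (int_S s1 U) = int_S s2 (box (dual_relation h) U)).
Proof.
split => [[mo qh] U /clopen_stone_map[b ->]|comm].
  rewrite box_stone_map // !int_S_stone_map.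
  apply/seteqP; split => x; rewrite box_prec_basic //.
    by move=> [c xc cb]; exists (h c); split => //; exact: mo.
  move=> [a [xa /qh[c ac cb]]]; exists c => //; exact: ultra_up ac xa.
have commb b (x : ultrafilter A2) :
    (exists2 c, ultra_set x (h c) & s1 c b) <-> prec_basic s2 (h b) x.
  rewrite -box_prec_basic // -!int_S_stone_map -box_stone_map //.
  by rewrite comm //; exact: stone_map_clopen.
split=> a b ab.
  have [x ax|e ae eb] := filter_ideal_meet (principal_filter (h a))
    (prec_down_ideal s2 (h b)).
    have [|e [xe eb]] := (commb b x).1; last by exists e.
    by exists a => //; apply: ax => /=.
  exact: prec_mono ae eb (lexx _).
have [x ax|e ae [c ec cb]] := filter_ideal_meet (principal_filter a)
  (prec_image_ideal hh s1 b).
  have [|c xc cb] := (commb b x).2; last by exists (h c) => //; exists c.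
  by exists a; split => //; apply: ax => /=.
by exists c => //; exact: le_trans ae ec.
Qed.
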